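(* Let $T$ be a non-trivial group, $m\geqslant 2$ an integer, let $\mathfrak{D}(T,m)$ be the diagonal semilattice and $\Gamma_D(T,m)$ the diagonal graph. Then the following hold. (a) The automorphism group of $\mathfrak{D}(T,m)$ is the diagonal group $D(T,m)$. (b) If $(|T|,m)\notin\{(2,2),(3,2),(4,2),(2,3)\}$, then the automorphism group of $\Gamma_D(T,m)$ is $D(T,m)$.
   Context: $T$ may be finite or infinite. Elements of $\Omega=T^m$ are written $[t_1,\ldots,t_m]$. Diagonal group. The pre-diagonal group $\widehat D(T,m)$ is the semidirect product $T^{m+1}\rtimes(\mathrm{Aut}(T)\times S_{m+1})$, where $\mathrm{Aut}(T)$ acts in the same way on each factor and $S_{m+1}$ permutes the factors. Let $\delta(T,m+1)=\{(t,\ldots,t)\mid t\in T\}\leqslant T^{m+1}$ and $\widehat H=\delta(T,m+1)\rtimes(\mathrm{Aut}(T)\times S_{m+1})$. The diagonal group $D(T,m)$ is the permutation group induced by $\widehat D(T,m)$ on the right cosets of $\widehat H$. Numbering the factors of $T^{m+1}$ as $0,\ldots,m$ and writing $[t_1,\ldots,t_m]$ for the coset of $(1,t_1,\ldots,t_m)$, this coset set is identified with $\Omega=T^m$, and $D(T,m)$ is the permutation group on $T^m$ generated by: right multiplications of the $i$th coordinate by elements of $T$ ($1\leqslant i\leqslant m$); simultaneous left multiplication of all coordinates by an element of $T$; automorphisms of $T$ applied simultaneously to all coordinates; permutations of the $m$ coordinates; and the map $[t_1,t_2,\ldots,t_m]\mapsto[t_1^{-1},t_1^{-1}t_2,\ldots,t_1^{-1}t_m]$.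 Diagonal semilattice. For $1\leqslant i\leqslant m$ let $T_i\leqslant T^m$ be the $i$th coordinate subgroup and let $T_0=\{[t,\ldots,t]\mid t\in T\}$. Let $Q_i$ be the partition of $T^m$ into right cosets of $T_i$ ($0\leqslant i\leqslant m$). For $I\subseteq\{0,\ldots,m\}$ let $Q_I=\bigvee_{i\in I}Q_i$, the supremum in the lattice of all partitions of $T^m$ ordered by refinement ($P\preccurlyeq Q$ iff every part of $P$ lies in a part of $Q$), with $Q_\emptyset$ the partition into singletons. Then $\mathfrak{D}(T,m)=\{Q_I\mid I\subseteq\{0,\ldots,m\}\}$. An automorphism of a set of partitions is a permutation of the underlying set that preserves the set of partitions. Diagonal graph. $\Gamma_D(T,m)$ has vertex set $T^m$; two distinct vertices are adjacent iff they lie in the same part of $Q_i$ for some $i\in\{0,\ldots,m\}$ (i.e. they differ in exactly one coordinate, or one is obtained from the other by left-multiplying all coordinates by the same non-identity element of $T$). *)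

(* Defs.v *)
From mathcomp Require Import all_boot all_fingroup.
From mathcomp Require Import boolp classical_sets functions cardinality.

Set Implicit Arguments.
Unset Strict Implicit.
Unset Printing Implicit Defensive.

Local Open Scope classical_set_scope.
Local Open Scope group_scope.

Section Cosets.
Variables (G : Type) (op : G -> G -> G).

Definition right_coset (H : set G) (x : G) : set G := [set op h x | h in H].

Definition right_cosets (H : set G) : set (set G) := range (right_coset H).

End Cosets.

Section Partitions.
Variable X : Type.
Implicit Types P Q S : set (set X).

Definition is_partition P : Prop := partition P id [set: X].

Definition refines P Q : Prop :=
  forall A, P A -> exists2 B, Q B & A `<=` B.

Definition is_join (F : set (set (set X))) S : Prop :=
  [/\ is_partition S,
      forall P, F P -> refines P S
    & forall S', is_partition S' -> (forall P, F P -> refines P S') ->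
        refines S S'].

Definition partition_image (f : X -> X) P : set (set X) :=
  [set f @` A | A in P].

Definition partition_set_aut (D : set (set (set X))) : set (X -> X) :=
  [set f | bijective f /\ partition_image f @` D = D].

Definition graph_aut (adj : X -> X -> Prop) : set (X -> X) :=
  [set f | bijective f /\ forall x y, adj (f x) (f y) <-> adj x y].

End Partitions.

(* T^n, indexed by {0, ..., n-1}. *)
Definition power (T : groupType) (n : nat) := {ffun 'I_n -> T}.

Definition pmul (T : groupType) (n : nat) (x y : power T n) : power T n :=
  [ffun i => x i * y i].

Section DiagonalGroup.
Variables (T : groupType) (m : nat).

Definition group_aut : set (T -> T) :=
  [set phi : T -> T | bijective phi /\ {morph phi : x y / x * y}].

(* A triple (a, phi, s) stands for the element a * (phi, s) of the semidirect
   product of T^(m+1) by Aut(T) x S_(m+1), the pair (phi, s) acting on the left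
   on T^(m+1) by b |-> (phi (b (s i)))_i. As the product of 'S_(m+1) is
   (s * t) i = t (s i), this is an action. *)
Definition prediag_elt : Type := power T m.+1 * (T -> T) * 'S_m.+1.

Definition prediag_mul (x y : prediag_elt) : prediag_elt :=
  let: (a, phi, s) := x in
  let: (b, psi, t) := y in
  (pmul a [ffun i => phi (b (s i))], phi \o psi, s * t).

Definition prediag_group : set prediag_elt :=
  [set x : prediag_elt | group_aut x.1.2].

Definition delta : set (power T m.+1) :=
  [set a : power T m.+1 | exists t : T, forall i, a i = t].

Definition prediag_point_stab : set prediag_elt :=
  [set x : prediag_elt | group_aut x.1.2 /\ delta x.1.1].

(* (t_1, ..., t_m) |-> (1, t_1, ..., t_m) *)
Definition cons1 (t : power T m) : power T m.+1 :=
  [ffun i => if unlift ord0 i is Some j then t j else 1].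

(* The coset denoted by [t_1, ..., t_m]; every right coset of the point
   stabiliser has this form for exactly one t. *)
Definition diag_point (t : power T m) : set prediag_elt :=
  right_coset prediag_mul prediag_point_stab (cons1 t, id, 1).

(* The permutations of T^m induced by right multiplication on the cosets. *)
Definition diagonal_group : set (power T m -> power T m) :=
  [set f | exists2 x, prediag_group x &
     forall t, [set prediag_mul y x | y in diag_point t] = diag_point (f t)].

End DiagonalGroup.

Section DiagonalSemilattice.
Variables (T : groupType) (m : nat).

(* Index 0 is the diagonal subgroup; index j + 1 is the coordinate subgroup
   for j : 'I_m, coordinates being numbered from 0. *)
Definition diag_subgroup (i : 'I_m.+1) : set (power T m) :=
  if unlift ord0 i is Some j
  then [set x : power T m | forall k, k != j -> x k = 1]
  else [set x : power T m | exists t : T, forall k, x k = t].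

Definition diag_partition (i : 'I_m.+1) : set (set (power T m)) :=
  right_cosets (@pmul T m) (diag_subgroup i).

(* For I empty the join is the partition into singletons. *)
Definition diagonal_semilattice : set (set (set (power T m))) :=
  [set P | exists I : {set 'I_m.+1},
     is_join [set diag_partition i | i in [set` I]] P].

Definition diagonal_graph (x y : power T m) : Prop :=
  x <> y /\ exists i, exists2 A, diag_partition i A & A x /\ A y.

End DiagonalSemilattice.

Arguments diagonal_group : clear implicits.
Arguments diagonal_semilattice : clear implicits.
Arguments diagonal_graph : clear implicits.

(* Main.v *)
(* Write a point of T^m in homogeneous coordinates (t_0 : ... : t_m), modulo
   simultaneous left multiplication.  Two points lie in the same part of Q_i
   when they agree off the coordinate i, and the diagonal group consists of the
   permutations f that permute the partitions Q_i.  Indeed, for such an f a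
   ratio t_i^-1 t_j of coordinates of the image of a point only depends on one
   such ratio of the point, and multiplicativity of the ratios forces this
   dependence to be, up to translations, one automorphism of T.

   An automorphism of the semilattice preserves refinement, hence permutes its
   atoms Q_i.

   For the graph, first recognise the lines (the parts of the Q_i): for m >= 3
   all triangles are collinear; for m = 2 a non-collinear triangle extends to a
   clique of size at most 4, while lines have at least 5 points.  Then recognise
   parallelism: for m = 2 the parallel lines are the disjoint ones; for m >= 3
   enough pairs of points at distance 2 have just two common neighbours, which
   together with the pair form a parallelogram with sides in two classes, so
   that the class of the image of a line is unchanged by translation. *)

Require Import Defs.
From mathcomp Require Import all_boot all_fingroup.
From mathcomp Require Import boolp classical_sets functions cardinality.

Set Implicit Arguments.
Unset Strict Implicit.
Unset Printing Implicit Defensive.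

Local Open Scope group_scope.

Lemma ord_avoid (n : nat) (s : seq 'I_n) : size s < n -> exists k, k \notin s.
Proof.
move=> lt_sn; apply: contrapT => all_s.
suff: size (enum 'I_n) <= size s by rewrite size_enum_ord leqNgt lt_sn.
apply: uniq_leq_size (enum_uniq _) _ => k _.
by apply: contrapT => /negP sk; apply: all_s; exists k.
Qed.

(** * Homogeneous coordinates and the equivalence relations of the [Q_i] *)

Section Coordinates.
Variables (T : groupType) (m : nat).
Implicit Types (x y z w : power T m) (i j k : 'I_m.+1) (h : 'I_m.+1 -> T).

Definition hpoint h : power T m := [ffun j => (h ord0)^-1 * h (lift ord0 j)].

Lemma cons1_ord0 x : cons1 x ord0 = 1.
Proof. by rewrite ffunE unlift_none. Qed.

Lemma cons1_lift x (j : 'I_m) : cons1 x (lift ord0 j) = x j.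
Proof. by rewrite ffunE liftK. Qed.

Lemma cons1_hpoint h k : cons1 (hpoint h) k = (h ord0)^-1 * h k.
Proof.
case: (unliftP ord0 k) => [j ->|->]; first by rewrite cons1_lift ffunE.
by rewrite cons1_ord0 mulVg.
Qed.

Lemma cons1_inj x y c : (forall k, cons1 y k = c * cons1 x k) -> x = y.
Proof.
move=> xy; have := xy ord0; rewrite !cons1_ord0 mulg1 => c1.
by apply/ffunP => j; have := xy (lift ord0 j); rewrite !cons1_lift -c1 mul1g.
Qed.

Lemma hpoint_eq h x c : (forall k, h k = c * cons1 x k) -> hpoint h = x.
Proof.
by move=> hx; apply/esym/(@cons1_inj _ _ ((h ord0)^-1 * c)) => k;
   rewrite cons1_hpoint (hx k) mulgA.
Qed.

(* In homogeneous coordinates (t_0 : ... : t_m) modulo left multiplication by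
   the diagonal, a part of Q_i consists of the points agreeing off i. *)
Definition prel i x y : Prop :=
  exists c, forall k, k != i -> cons1 y k = c * cons1 x k.

Lemma prel_refl i x : prel i x x.
Proof. by exists 1 => k _; rewrite mul1g. Qed.

Lemma prel_sym i x y : prel i x y -> prel i y x.
Proof. by case=> c xy; exists c^-1 => k /xy ->; rewrite mulKg. Qed.

Lemma prel_trans i y x z : prel i x y -> prel i y z -> prel i x z.
Proof.
by move=> [c xy] [d yz]; exists (d * c) => k ki; rewrite yz ?xy ?mulgA.
Qed.

Lemma prel_hpointr i x h c :
  (forall k, k != i -> h k = c * cons1 x k) -> prel i x (hpoint h).
Proof.
by move=> hx; exists ((h ord0)^-1 * c) => k ki; rewrite cons1_hpoint (hx k) ?mulgA.
Qed.

Lemma prel_hpoint i h h' c :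
  (forall k, k != i -> h' k = c * h k) -> prel i (hpoint h) (hpoint h').
Proof.
move=> hh; apply: (@prel_hpointr _ _ _ (c * h ord0)) => k ki.
by rewrite cons1_hpoint hh // mulgA mulgK.
Qed.

(** For a coordinate subgroup, comparing coordinate 0 forces the multiplier in [prel] to be 1; for
    the diagonal subgroup coordinate 0 is free and the multiplier is the diagonal element itself. *)
Lemma diag_subgroup_coset i z :
  right_coset (@pmul T m) (@diag_subgroup T m i) z = [set y | prel i z y]%classic.
Proof.
apply/seteqP; split=> y /=.
  rewrite /diag_subgroup; case: (unliftP ord0 i) => [j|] -> /=.
    case=> g g1 <-; exists 1 => k; case: (unliftP ord0 k) => [l|] ->.
      by rewrite (inj_eq lift_inj) !cons1_lift mul1g ffunE => /g1 ->;
         rewrite mul1g.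
    by rewrite !cons1_ord0 mulg1.
  case=> g [t gt] <-; exists t => k; case: (unliftP ord0 k) => [l|] ->.
    by rewrite !cons1_lift ffunE gt.
  by rewrite eqxx.
case=> c zy; rewrite /diag_subgroup; exists [ffun k => y k * (z k)^-1]; last first.
  by apply/ffunP => k; rewrite !ffunE mulgVK.
move: zy; case: (unliftP ord0 i) => [j|] -> zy /=.
  move=> k kj; have := zy ord0; rewrite (neq_lift _ _) => /(_ isT).
  rewrite !cons1_ord0 mulg1 => c1; have := zy (lift ord0 k).
  rewrite (inj_eq lift_inj) kj => /(_ isT).
  by rewrite !cons1_lift -c1 mul1g ffunE => ->; rewrite mulgV.
exists c => k; have := zy (lift ord0 k); rewrite eq_sym neq_lift => /(_ isT).
by rewrite !cons1_lift ffunE => ->; rewrite mulgK.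
Qed.

Lemma diag_partitionE i :
  @diag_partition T m i = range (fun z => [set y | prel i z y]%classic).
Proof.
rewrite /diag_partition /right_cosets.
by congr (image _ _); apply/funext => z; rewrite diag_subgroup_coset.
Qed.

Lemma diagonal_graphE x y :
  diagonal_graph T m x y <-> x <> y /\ exists i, prel i x y.
Proof.
split=> -[xy [i xiy]]; split=> //; exists i.
  move: xiy => [A]; rewrite diag_partitionE => -[z _ <-] /= [zx zy].
  exact: prel_trans (prel_sym zx) zy.
exists [set y | prel i x y]%classic; first by rewrite diag_partitionE; exists x.
by split=> //=; apply: prel_refl.
Qed.

(** The fourth vertex takes its coordinate [i] from [y] and its coordinate [j] from [z], both
    rescaled to agree with [x] elsewhere. *)
Lemma prel_parallelogram i j x y z :
  prel i x y -> prel j x z -> exists2 w, prel j y w & prel i w z.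
Proof.
have [<- xy xz|neq_ij [c xy] [d xz]] := eqVneq i j.
  by exists y; [apply: prel_refl | apply: prel_trans (prel_sym xy) xz].
exists (hpoint (fun k => if k == i then c^-1 * cons1 y i else
                         if k == j then d^-1 * cons1 z j else cons1 x k)).
  apply: (@prel_hpointr _ _ _ c^-1) => k kj; rewrite (negPf kj).
  by case: (eqVneq k i) => [-> //|ki]; rewrite xy // mulKg.
apply/prel_sym/(@prel_hpointr _ _ _ d^-1) => k ki; rewrite (negPf ki).
by case: (eqVneq k j) => [-> //|kj]; rewrite xz // mulKg.
Qed.

(* Change the coordinates one at a time. *)
Lemma prel_connected (A : pred 'I_m.+1) (P : power T m -> Prop) x y c :
  (forall k, A k -> cons1 y k = c * cons1 x k) ->
  (forall j z w, ~~ A j -> prel j z w -> P z -> P w) ->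
  P x -> P y.
Proof.
move=> Axy step Px.
pose h N k := if k < N then cons1 y k else c * cons1 x k.
have Ph N : P (hpoint (h N)).
  elim: N => [|N IH]; first by rewrite (@hpoint_eq _ x c).
  have [NA|NA] := pselect (exists2 k : 'I_m.+1, ~~ A k & k = N :> nat).
    case: NA => j Aj jN; apply: step Aj _ IH; apply: (@prel_hpoint _ _ _ 1) => k.
    by rewrite -val_eqE /= jN => kN; rewrite mul1g /h ltnS leq_eqVlt (negPf kN).
  suff ->: h N.+1 = h N by [].
  apply/funext => k; rewrite /h ltnS leq_eqVlt.
  have [kN|//] := eqVneq (val k) N; rewrite /= -kN ltnn.
  by apply: Axy; apply: contrapT => /negP Ak; apply: NA; exists k.
by rewrite -(@hpoint_eq (h m.+1) y 1) // => k; rewrite /h ltn_ord mul1g.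
Qed.

Section AtLeastThreeCoordinates.
Hypothesis m_ge2 : 2 <= m.

(** An index off [i] and [j] shows that the two multipliers agree, so the points are proportional
    everywhere. *)
Lemma prel_inter i j x y : i != j -> prel i x y -> prel j x y -> x = y.
Proof.
move=> neq_ij [c xy] [d xy'].
have [|k] := @ord_avoid _ [:: i; j]; first exact: m_ge2.
rewrite !inE negb_or => /andP[ki kj].
have cd : c = d by apply: (mulIg (cons1 x k)); rewrite -xy // -xy'.
apply: (@cons1_inj _ _ c) => l; have [->|/xy //] := eqVneq l i.
by rewrite cd xy'.
Qed.

Lemma prel_avoid (n : nat) i x (s : seq (power T m)) :
  (forall r : seq T, size r <= n -> exists t, t \notin r) ->
  size s <= n -> exists2 y, prel i x y & y \notin s.
Proof.
move=> avoidT sn.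
have [|k] := @ord_avoid _ [:: i]; first exact: ltnW m_ge2.
rewrite !inE => ki.
(* The coordinate [i] of [y] once [y] is rescaled to agree with [x] at [k]. *)
pose coord (y : power T m) := cons1 x k * (cons1 y k)^-1 * cons1 y i.
have [|t] := avoidT [seq coord y | y <- s]; first by rewrite size_map.
move=> ts; pose h l := if l == i then t else cons1 x l.
exists (hpoint h).
  by apply: (@prel_hpointr _ _ _ 1) => l li; rewrite /h (negPf li) mul1g.
apply: contra ts => /(map_f coord); rewrite /coord !cons1_hpoint /h eqxx (negPf ki).
by rewrite invMg mulVKg mulKg.
Qed.

End AtLeastThreeCoordinates.

End Coordinates.

(** * The diagonal group as the group of permutations permuting the [Q_i] *)

Section DiagonalGroup.
Variables (T : groupType) (m : nat).
Implicit Types (x y z w : power T m) (i j k : 'I_m.+1).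

Lemma group_aut1 (phi : T -> T) : group_aut phi -> phi 1 = 1.
Proof. by case=> _ phiM; apply: (mulgI (phi 1)); rewrite -phiM !mulg1. Qed.

Lemma group_aut_comp (phi psi : T -> T) :
  group_aut phi -> group_aut psi -> group_aut (phi \o psi).
Proof.
move=> [phi_bij phiM] [psi_bij psiM]; split; first exact: bij_comp.
by move=> a b /=; rewrite psiM phiM.
Qed.

Lemma group_aut_inv (phi psi : T -> T) :
  group_aut phi -> cancel phi psi -> cancel psi phi -> group_aut psi.
Proof.
move=> [phi_bij phiM] phiK psiK; split; first by exists phi.
by move=> a b; apply: (can_inj phiK); rewrite phiM !psiK.
Qed.

Lemma diag_pointE (x : power T m) (e : power T m.+1) chi (q : 'S_m.+1) :
  diag_point x (e, chi, q) <->
  group_aut chi /\ exists d, forall k, e k = d * chi (cons1 x (q k)).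
Proof.
split=> [[[[d psi] r] /= [aut_psi [t dt]] [<- <- <-]]|[aut_chi [d ed]]].
  split; first by [].
  by exists t => k; rewrite mulg1 !ffunE dt.
exists ([ffun=> d], chi, q); first by split=> //=; exists d => k; rewrite ffunE.
rewrite /= mulg1; congr (_, _, _).
by apply/ffunP => k; rewrite !ffunE ed ffunE.
Qed.

(** The triple [(a, phi, s)] sends the representative [(cons1 x, id, 1)] to one with first component
    [cons1 x k * a k]; [diag_pointE] tells when this lies in the coset of [f x]. *)
Lemma diagonal_groupP (f : power T m -> power T m) :
  diagonal_group T m f <->
  exists a phi (s : 'S_m.+1), group_aut phi /\
    forall x, exists c, forall k, phi (cons1 (f x) (s k)) = c * cons1 x k * a k.
Proof.
split=> [[[[a phi] s] /= aut_phi fP]|[a [phi [s [aut_phi fP]]]]].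
  exists a, phi, s; split=> // x.
  have : diag_point (f x) (prediag_mul (cons1 x, id, 1) (a, phi, s)).
    rewrite -fP; exists (cons1 x, id, 1) => //; apply/diag_pointE; split.
      by split=> //; exists id.
    by exists 1 => k; rewrite perm1 mul1g.
  rewrite /prediag_mul mul1g => /diag_pointE[_ [d dx]].
  exists d^-1 => k; move: (dx k); move: (cons1 x) (cons1 (f x)) => u v.
  by rewrite !ffunE !perm1 -mulgA => ->; rewrite mulKg.
exists ([ffun k => a k], phi, s) => // x; have [c fx] := fP x.
apply/seteqP; split=> [_ [[[e chi] q] /diag_pointE [aut_chi [d ed]] <-]|].
  apply/diag_pointE; split; first exact: group_aut_comp.
  exists (d * (chi c)^-1) => k /=; rewrite permM fx.
  move: (cons1 x) ed => u ed; rewrite !ffunE ed.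
  by rewrite !(proj2 aut_chi) !mulgA mulgVK.
move=> [[e chi] q] /diag_pointE[aut_chi [d ed]].
have [psi phiK psiK] := proj1 aut_phi.
have aut_psi := group_aut_inv aut_phi phiK psiK.
have aut_cp := group_aut_comp aut_chi aut_psi.
(* The preimage of [(e, chi, q)] is its product with the inverse of [(a, phi, s)]. *)
pose r := q * s^-1.
exists ([ffun k => d * chi (psi (c * cons1 x (r k)))], chi \o psi, r).
  apply/diag_pointE; split=> //; exists (d * chi (psi c)) => k.
  by rewrite ffunE /= -mulgA -(proj2 aut_chi) -(proj2 aut_psi).
rewrite /= /r mulgVK; congr (_, _, _); last by apply/funext => t /=; rewrite phiK.
apply/ffunP => k; rewrite ed; have := fx (r k).
have -> : s (r k) = q k by rewrite permM permKV.
move: (cons1 x) (cons1 (f x)) => u v uv.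
by rewrite !ffunE -mulgA -(proj2 aut_chi) -(proj2 aut_psi) -uv phiK.
Qed.

Definition diag_class_perm (f : power T m -> power T m) : Prop :=
  bijective f /\ exists s : 'S_m.+1,
    forall i x y, prel i x y <-> prel (s i) (f x) (f y).

Lemma diagonal_group_class_perm f : diagonal_group T m f -> diag_class_perm f.
Proof.
move=> /diagonal_groupP[a [phi [s [aut_phi fP]]]].
have [psi phiK psiK] := proj1 aut_phi; have phiM := proj2 aut_phi.
split; last first.
  exists s => i x y; have [c fx] := fP x; have [d fy] := fP y.
  split=> -[e xy].
    exists (psi (d * e * c^-1)) => k; rewrite -(permKV s k) (inj_eq perm_inj) => ki.
    apply: (can_inj phiK); rewrite phiM psiK fx fy xy //.
    by rewrite !mulgA mulgVK.
  exists (d^-1 * phi e * c) => k ki; have := xy (s k).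
  rewrite (inj_eq perm_inj) => /(_ ki) /(congr1 phi).
  rewrite phiM fx fy !mulgA => /mulIg/(congr1 (mulg d^-1)).
  by rewrite -mulgA mulKg !mulgA.
have surj y : exists x, f x = y.
  (* [h] solves the relation of [diagonal_groupP] for a preimage of [y], with multiplier 1. *)
  pose h k := phi (cons1 y (s k)) * (a k)^-1.
  exists (hpoint h); have [c fx] := fP (hpoint h).
  apply/esym/(@cons1_inj _ _ _ _ (psi (c * (h ord0)^-1))) => k.
  rewrite -(permKV s k); apply: (can_inj phiK); rewrite phiM psiK fx cons1_hpoint.
  by rewrite /h !mulgA mulgVK.
have [g fgK] := choice surj.
exists g => // x; apply/(@cons1_inj _ _ _ _ 1).
have [c fx] := fP x; have [d fgx] := fP (g (f x)).
have cons_gfx k : cons1 x k = c^-1 * d * cons1 (g (f x)) k.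
  by apply: (mulgI c); apply: (mulIg (a k)); rewrite -fx !mulgA mulgV mul1g -fgx fgK.
move=> k; have := cons_gfx ord0; rewrite !cons1_ord0 mulg1 => cd.
by rewrite cons_gfx -cd.
Qed.

Section Coordinatisation.
Variables (f g : power T m -> power T m) (s : 'S_m.+1).
Hypothesis m_ge2 : 2 <= m.
Hypotheses (fK : cancel f g) (gK : cancel g f).
Hypothesis g_prel : forall i x y, prel (s i) x y -> prel i (g x) (g y).

Let o : power T m := [ffun=> 1].
Let i0 := s^-1 ord0.
Let a k : T := cons1 (g o) k.
(** [F] right-translates [g x] so that [g o] gets all coordinates 1; the ratios [N] do not change
    when homogeneous coordinates are multiplied on the left. *)
Let F x k : T := cons1 (g x) k * (a k)^-1.
Let N x i j : T := (F x i)^-1 * F x j.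
Let pt p (t : T) q (u : T) : power T m :=
  hpoint (fun k => if k == s p then t else if k == s q then u else 1).

Let s_i0 : s i0 = ord0. Proof. by rewrite /i0 permKV. Qed.

Let cons1_o k : cons1 o k = 1.
Proof. by rewrite ffunE; case: unlift => // j; rewrite ffunE. Qed.

Let cons1_pt p t q u k : p != i0 -> q != i0 ->
  cons1 (pt p t q u) k = if k == s p then t else if k == s q then u else 1.
Proof.
have ord0_s r : r != i0 -> (ord0 == s r) = false.
  by rewrite -(inj_eq (@perm_inj _ s)) s_i0 eq_sym => /negPf.
by move=> /ord0_s pi /ord0_s qi; rewrite cons1_hpoint pi qi invg1 mul1g.
Qed.

(* A ratio of two coordinates of g x only depends on the corresponding ratio
   for x: the other coordinates of x can be changed freely. *)
Let ratio_eq x y c i j :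
  cons1 y (s i) = c * cons1 x (s i) -> cons1 y (s j) = c * cons1 x (s j) ->
  N y i j = N x i j.
Proof.
move=> xyi xyj.
apply: (@prel_connected _ _ [pred k | (k == s i) || (k == s j)]
          (fun w => N w i j = N x i j) x y c) => //= [k /orP[]/eqP -> //|].
move=> k z w; rewrite negb_or -(permKV s k) !(inj_eq perm_inj) => /andP[ki kj].
move=> /g_prel[d zw] <-; rewrite /N /F !zw 1?eq_sym //.
by rewrite !invMg !mulgA mulgVK.
Qed.

Let ratioM x i j k : N x i j * N x j k = N x i k.
Proof. by rewrite /N mulgA mulgK. Qed.

Let ratio_o i j : N o i j = 1.
Proof. by rewrite /N /F !mulgV mulVg. Qed.

Let phi_ j t := N (pt j t j t) i0 j.

(** [s i0] is coordinate 0, which is 1 at every point, so this ratio depends on the coordinate [s j]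
    alone. *)
Let ratio_i0 x j : j != i0 -> N x i0 j = phi_ j (cons1 x (s j)).
Proof.
move=> ji; apply: (@ratio_eq _ _ 1); rewrite mul1g.
  by rewrite s_i0 !cons1_ord0.
by rewrite cons1_pt // eqxx.
Qed.

(** By multiplicativity the left side is the ratio between [i] and [j] at a point with coordinates
    [t] and [u] there; left division by [t] turns these into [1] and [t^-1 * u], where the ratio is
    the right side. *)
Let phi_V_M i j t u : i != i0 -> j != i0 -> i != j ->
  (phi_ i t)^-1 * phi_ j u = phi_ j (t^-1 * u).
Proof.
move=> ii ji ij.
have ratioV x : (N x i0 i)^-1 * N x i0 j = N x i j.
  by apply: (mulgI (N x i0 i)); rewrite mulVKg ratioM.
have ptE v r : (phi_ i v)^-1 * phi_ j r = N (pt i v j r) i j.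
  rewrite -ratioV !ratio_i0 // !cons1_pt // eqxx (inj_eq perm_inj).
  by rewrite [j == i]eq_sym (negPf ij) eqxx.
have phi1 : phi_ i 1 = 1 by rewrite -(cons1_o (s i)) -ratio_i0 ?ratio_o.
rewrite -[RHS]mul1g -[in RHS]invg1 -[in RHS]phi1 !ptE.
apply: (@ratio_eq _ _ t); rewrite !cons1_pt // !eqxx ?mulg1 //.
by rewrite (inj_eq perm_inj) [j == i]eq_sym (negPf ij) mulVKg.
Qed.

Let phi_eq i j t : i != i0 -> j != i0 -> phi_ i t = phi_ j t.
Proof.
move=> ii ji; have [->//|ij] := eqVneq i j.
apply: (mulgI (phi_ i t)^-1); rewrite mulVg phi_V_M // mulVg.
by rewrite -(cons1_o (s j)) -ratio_i0 ?ratio_o.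
Qed.

Lemma coordinatisation : exists phi, group_aut phi /\
  forall x, exists c, forall k, cons1 (g x) k = c * phi (cons1 x (s k)) * a k.
Proof.
have [|i1] := @ord_avoid _ [:: i0]; first exact: ltnW.
rewrite inE => i1i0.
(* [phi_V_M] needs two different indices besides [i0]. *)
have [|i2] := @ord_avoid _ [:: i0; i1]; first exact: m_ge2.
rewrite !inE negb_or => /andP[i2i0 i2i1].
pose phi := phi_ i1.
have phi_V t u : (phi t)^-1 * phi u = phi (t^-1 * u).
  by rewrite /phi -(phi_eq t i2i0 i1i0) phi_V_M.
have phi1 : phi 1 = 1 by rewrite -[1 in LHS](mulVg 1) -phi_V mulVg.
have phiV t : (phi t)^-1 = phi t^-1.
  by rewrite -[LHS]mulg1 -phi1 phi_V mulg1.
have phiM t u : phi (t * u) = phi t * phi u.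
  by rewrite -[t in LHS]invgK -phi_V -phiV invgK.
have phiP x : exists c, forall k, cons1 (g x) k = c * phi (cons1 x (s k)) * a k.
  exists (F x i0) => k; have [->|ki0] := eqVneq k i0.
    by rewrite s_i0 cons1_ord0 phi1 mulg1 mulgVK.
  by rewrite /phi (phi_eq _ i1i0 ki0) -ratio_i0 // mulVKg mulgVK.
exists phi; split=> //; split=> //.
have phi_ker t : phi t = 1 -> t = 1.
  move=> phit; pose x := pt i1 t i1 t.
  have [c gx] := phiP x.
  have gxo : g x = g o.
    apply/esym/(@cons1_inj _ _ _ _ c) => k; rewrite gx cons1_pt //.
    by rewrite !(fun_if phi) phit phi1 !if_same mulg1.
  have := cons1_o (s i1); rewrite -(can_inj gK gxo) cons1_pt // eqxx //.
have phi_inj : injective phi.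
  move=> t u tu; apply: (mulgI t^-1); rewrite mulVg; apply/esym/phi_ker.
  by rewrite -phi_V tu mulVg.
have phi_surj u : exists t, phi t = u.
  (* The point with coordinates [h] differs from [g o] only by the left factor [u] at [i1], so [phi]
     takes the value [u] at coordinate [s i1] of its preimage under [g]. *)
  pose h k := if k == i1 then u * a k else a k.
  have [c] := phiP (f (hpoint h)); rewrite fK => hP.
  have := hP i0; have := hP i1; rewrite !cons1_hpoint s_i0 cons1_ord0 phi1 mulg1.
  rewrite /h eqxx [i0 == i1]eq_sym (negPf i1i0) => hP1 /mulIg ch.
  move: hP1; rewrite -ch mulgA => /mulIg/mulgI ->.
  by eexists.
have [psi psiK] := choice phi_surj.
by exists psi => // t; apply: phi_inj; rewrite psiK.
Qed.

(** The formula for [g], taken at [f x], has [phi] on the coordinates of [f x], as [diagonal_groupP]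
    wants; hence it is the inverse of [f] that is coordinatised. *)
Lemma class_perm_inv_diagonal_group : diagonal_group T m f.
Proof.
have [phi [aut_phi phiP]] := coordinatisation.
apply/diagonal_groupP; exists [ffun k => (a k)^-1], phi, s; split=> // x.
have [c] := phiP (f x); rewrite fK => xP; exists c^-1 => k.
by rewrite xP ffunE !mulgA mulVg mul1g mulgK.
Qed.

End Coordinatisation.

Lemma diagonal_groupE : 2 <= m -> diagonal_group T m = diag_class_perm.
Proof.
move=> m_ge2; apply/seteqP; split=> f; first exact: diagonal_group_class_perm.
case=> -[g fK gK] [s fP].
apply: (class_perm_inv_diagonal_group (s := s) m_ge2 fK gK) => i x y.
by move=> xy; apply/fP; rewrite !gK.
Qed.

End DiagonalGroup.

(** * Transport of partitions and joins along a bijection *)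

Section PartitionImage.
Variable X : Type.
Implicit Types (f g : X -> X) (P S : set (set X)) (F : set (set (set X))).

Lemma partition_imageK f g P :
  cancel f g -> partition_image g (partition_image f P) = P.
Proof.
move=> fK; rewrite /partition_image image_comp -[RHS]image_id.
congr (image _ _); apply/funext => A /=; rewrite image_comp -[RHS]image_id.
by congr (image _ _); apply/funext => x /=; rewrite fK.
Qed.

Lemma refines_image f P S :
  refines P S -> refines (partition_image f P) (partition_image f S).
Proof.
move=> PS _ [A /PS[B SB AB] <-]; exists (f @` B)%classic; first by exists B.
exact: image_subset.
Qed.

Lemma is_partition_image f P :
  bijective f -> is_partition P -> is_partition (partition_image f P).
Proof.
move=> [g fK gK] [coverP trivP neP]; split.
- apply/seteqP; split=> // y _.
  have : (\bigcup_(A in P) A)%classic (g y) by rewrite [X in X _]coverP.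
  case=> A PA Ay; exists (f @` A)%classic; first by exists A.
  by exists (g y); rewrite ?gK.
- move=> _ _ [A PA <-] [B PB <-] [y [[a Aa <-] [b Bb /(can_inj fK) eq_ba]]].
  by rewrite (trivP A B) //; exists a; split=> //; rewrite -eq_ba.
- by move=> _ [A /neP[a Aa] <-]; exists (f a), a.
Qed.

Lemma is_join_image f F S : bijective f -> is_join F S ->
  is_join [set partition_image f P | P in F]%classic (partition_image f S).
Proof.
move=> f_bij [partS ubS lubS]; split; first exact: is_partition_image.
  by move=> _ [P FP <-]; apply: refines_image; apply: ubS.
move=> S' partS' ubS'; have [g fK gK] := f_bij.
rewrite -(partition_imageK S' gK); apply/refines_image/lubS.
  by apply: is_partition_image => //; exists f.
move=> P FP; rewrite -(partition_imageK P fK); apply: refines_image.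
by apply: ubS'; exists P.
Qed.

Lemma is_partition_set1 : is_partition (range (@set1 X)).
Proof.
split; first by apply/seteqP; split=> // x _; exists [set x]%classic.
  by move=> _ _ [x _ <-] [y _ <-] [z [/= -> ->]].
by move=> _ [x _ <-]; exists x.
Qed.

Definition discrete P := forall A x y, P A -> A x -> A y -> x = y.

Lemma discrete_image f P :
  injective f -> discrete (partition_image f P) -> discrete P.
Proof.
move=> f_inj dP A x y PA Ax Ay; apply: f_inj.
by apply: (dP (f @` A)%classic); [exists A | exists x | exists y].
Qed.

End PartitionImage.

(** * Automorphisms of the diagonal semilattice *)

Section SemilatticeAutomorphisms.
Variables (T : groupType) (m : nat).
Hypothesis m_ge2 : 2 <= m.
Implicit Types (x y z w : power T m) (i j k : 'I_m.+1).
Implicit Types (f g : power T m -> power T m) (P : set (set (power T m))).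

Local Notation Q := (@diag_partition T m).
Local Notation semilattice := (diagonal_semilattice T m).

Lemma diag_partition_partition i : is_partition (Q i).
Proof.
rewrite diag_partitionE; split.
- apply/seteqP; split=> // x _; exists [set y | prel i x y]%classic; first by exists x.
  exact: prel_refl.
- move=> _ _ [x _ <-] [y _ <-] [z [/= xz yz]].
  have xy := prel_trans xz (prel_sym yz).
  apply/seteqP; split=> w /=; last exact: prel_trans.
  exact: prel_trans (prel_sym xy).
- by move=> _ [x _ <-]; exists x; apply: prel_refl.
Qed.

Lemma refines_image_diag_partition f i j x y :
  refines (partition_image f (Q i)) (Q j) -> prel i x y -> prel j (f x) (f y).
Proof.
move=> QP xy; have [|A] := QP (f @` [set z | prel i x z])%classic.
  by exists [set z | prel i x z]%classic => //; rewrite diag_partitionE; exists x.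
rewrite diag_partitionE => -[z _ <-] sub.
have zf w : prel i x w -> prel j z (f w) by move=> xw; apply: sub; exists w.
by apply: prel_trans (prel_sym _) _; apply: zf => //; apply: prel_refl.
Qed.

Lemma diag_partition_semilattice i : semilattice (Q i).
Proof.
exists [set i]; split; first exact: diag_partition_partition.
  by move=> P [j /= + <-]; rewrite finset.in_set1 => /eqP -> A QA; exists A.
by move=> S' _ ubS'; apply: ubS'; exists i; rewrite //= finset.in_set1.
Qed.

Lemma semilattice_atom P :
  semilattice P -> ~ discrete P -> exists j, refines (Q j) P.
Proof.
move=> [I [_ ubP lubP]] ndP; have [I0|[j Ij]] := set_0Vmem I; last first.
  by exists j; apply: ubP; exists j.
exfalso; apply: ndP => A x y PA Ax Ay.
have PS : refines P (range (@set1 (power T m))).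
  apply: lubP => [|P' [j /= + _]]; first exact: is_partition_set1.
  by rewrite I0 finset.in_set0.
by have [_ [z _ <-] sub] := PS A PA; rewrite (sub x Ax) (sub y Ay).
Qed.

Lemma image_diag_partition f (s : 'S_m.+1) i : bijective f ->
  (forall i x y, prel i x y <-> prel (s i) (f x) (f y)) ->
  partition_image f (Q i) = Q (s i).
Proof.
move=> [g fK gK] sP; rewrite !diag_partitionE.
have im z : (f @` [set y | prel i z y] = [set y | prel (s i) (f z) y])%classic.
  apply/seteqP; split=> [_ [y /= zy <-]|y /= zy]; first by rewrite -sP.
  by exists (g y); rewrite /= 1?sP gK.
apply/seteqP; split=> [_ [_ [z _ <-] <-]|_ [z _ <-]].
  by rewrite im; exists (f z).
exists [set y | prel i (g z) y]%classic; first by exists (g z).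
by rewrite im gK.
Qed.

Lemma image_semilattice f (s : 'S_m.+1) P : bijective f ->
  (forall i x y, prel i x y <-> prel (s i) (f x) (f y)) ->
  semilattice P -> semilattice (partition_image f P).
Proof.
move=> f_bij sP [I joinI]; exists (s @: I)%SET.
suff -> : ([set Q i | i in [set` s @: I]%SET] =
           partition_image f @` [set Q i | i in [set` I]])%classic.
  exact: is_join_image.
apply/seteqP; split=> [_ [_ /imsetP[i Ii ->] <-]|_ [_ [i Ii <-] <-]].
  by exists (Q i); [exists i | apply: image_diag_partition].
by exists (s i); [apply: imset_f | rewrite (image_diag_partition _ f_bij sP)].
Qed.

Lemma class_perm_semilattice_aut f :
  diag_class_perm f -> partition_set_aut semilattice f.
Proof.
move=> [f_bij [s sP]]; split=> //; have [g fK gK] := f_bij.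
apply/seteqP; split=> [_ [P DP <-]|P DP]; first exact: image_semilattice DP.
exists (partition_image g P); last exact: partition_imageK.
apply: (@image_semilattice _ s^-1) DP; first by exists f.
by move=> i x y; rewrite -{1}(permKV s i) -{1}(gK x) -{1}(gK y) -sP.
Qed.

Hypothesis T_nontrivial : exists t : T, t <> 1.

Lemma nontrivial_avoid (r : seq T) : size r <= 1 -> exists t, t \notin r.
Proof.
case: T_nontrivial => t /eqP t1; case: r => [|a [|//]] _; first by exists 1.
have [->|] := eqVneq a 1; first by exists t; rewrite inE.
by exists 1; rewrite inE eq_sym.
Qed.

Lemma prel_nontrivial i x : exists2 y, prel i x y & x <> y.
Proof.
have [//|y xy] := @prel_avoid T m m_ge2 1 i x [:: x] nontrivial_avoid.
by rewrite inE eq_sym => /eqP; exists y.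
Qed.

Lemma diag_partition_not_discrete i : ~ discrete (Q i).
Proof.
have [y xy neq_xy] := prel_nontrivial i [ffun=> 1].
move=> dQ; apply: neq_xy; apply: (dQ [set y | prel i [ffun=> 1] y]%classic) => //.
  by rewrite diag_partitionE; exists [ffun=> 1].
exact: prel_refl.
Qed.

(** Each part of [Q_i] has at least two points, while parts of different partitions share at most
    one. *)
Lemma prel_sub_eq i j : (forall x y, prel i x y -> prel j x y) -> i = j.
Proof.
move=> sub; have [y xy neq_xy] := prel_nontrivial i [ffun=> 1].
by apply: contra_notP neq_xy => /eqP ij; apply: (prel_inter m_ge2 ij) => //; apply: sub.
Qed.

(** Some [Q_j] refines the image of [Q_i], and some [Q_k] refines the preimage of [Q_j]. Then [Q_k]
    refines [Q_i], so [k = i] and both refinements are equalities. *)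
Lemma semilattice_aut_class_perm f :
  partition_set_aut semilattice f -> diag_class_perm f.
Proof.
move=> [f_bij fD]; split=> //; have [g fK gK] := f_bij.
have classes i : exists j, forall x y, prel i x y <-> prel j (f x) (f y).
  have fQi : semilattice (partition_image f (Q i)).
    by rewrite -[X in X _]fD; exists (Q i) => //; apply: diag_partition_semilattice.
  have [|j QjfQi] := semilattice_atom fQi.
    by move=> /(discrete_image (can_inj fK)); apply: diag_partition_not_discrete.
  have := diag_partition_semilattice j; rewrite -[X in X _]fD => -[P DP fP].
  have [|k QkP] := semilattice_atom DP.
    rewrite -(partition_imageK P fK) fP.
    by move=> /(discrete_image (can_inj gK)); apply: diag_partition_not_discrete.
  have fQi_sub x y : prel j (f x) (f y) -> prel i x y.
    move=> /(@refines_image_diag_partition g j i); rewrite !fK; apply.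
    by rewrite -(partition_imageK (Q i) fK); apply: refines_image.
  have Qk_sub x y : prel k x y -> prel j (f x) (f y).
    apply: refines_image_diag_partition; rewrite -fP; exact: refines_image.
  have ki : k = i by apply: prel_sub_eq => x y /Qk_sub/fQi_sub.
  by exists j => x y; split=> [|/fQi_sub//]; rewrite -ki; apply: Qk_sub.
have [s sP] := choice classes.
have s_inj : injective s.
  move=> i j sij; apply: prel_sub_eq => x y /sP; rewrite sij => ?; exact/sP.
by exists (perm s_inj) => i x y; rewrite permE.
Qed.

Lemma semilattice_autE : partition_set_aut semilattice = diagonal_group T m.
Proof.
rewrite diagonal_groupE //; apply/seteqP; split=> f.
  exact: semilattice_aut_class_perm.
exact: class_perm_semilattice_aut.
Qed.

End SemilatticeAutomorphisms.

(** * Triangles and common neighbours in the diagonal graph *)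

Section GraphGeometry.
Variables (T : groupType) (m : nat).
Hypothesis m_ge2 : 2 <= m.
Implicit Types (x y z w u v : power T m) (i j k : 'I_m.+1).

Local Notation adj := (diagonal_graph T m).

(** If the three classes were distinct, an index off all of them would make the multipliers
    compatible, and [x] and [y] would agree at [i] too. Otherwise [prel_inter] applies. *)
Lemma triangle_collinear i j k x y z : 3 <= m -> x <> y -> y <> z ->
  prel i x y -> prel j y z -> prel k x z -> i = j.
Proof.
move=> m_ge3 neq_xy neq_yz xy yz xz; apply/eqP/contraT => ij.
have [eq_ki|ki] := eqVneq k i.
  rewrite {}eq_ki in xz; case: neq_yz; apply: (prel_inter m_ge2 ij) => //.
  exact: prel_trans (prel_sym xy) xz.
have [eq_kj|kj] := eqVneq k j.
  rewrite {}eq_kj in xz; case: neq_xy; apply: (prel_inter m_ge2 ij) => //.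
  exact: prel_trans xz (prel_sym yz).
have [|l] := @ord_avoid _ [:: i; j; k]; first exact: m_ge3.
rewrite !inE !negb_or => /and3P[li lj lk].
case: xy yz xz => c xy [d yz] [e xz]; case: neq_xy; apply: (@cons1_inj _ _ _ _ c).
have ecd : e = d * c.
  by apply: (mulIg (cons1 x l)); rewrite -xz // -mulgA -xy // yz.
move=> p; have [->|/xy //] := eqVneq p i; apply: (mulgI d).
by rewrite -yz // mulgA -ecd xz // eq_sym.
Qed.

Lemma three_indices i j k l : m = 2 -> i != j -> k != i -> k != j ->
  [|| l == i, l == j | l == k].
Proof.
move=> m2 ij ki kj; apply: contraT; rewrite !negb_or => /and3P[li lj lk].
have : size [:: l; i; j; k] <= size (enum 'I_m.+1).
  apply: uniq_leq_size => [|p _]; last by rewrite mem_enum.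
  by rewrite /= !inE !negb_or li lj lk ij ![_ == k]eq_sym ki kj.
by rewrite size_enum_ord /= m2.
Qed.

(** Giving [x] the coordinate [i] of [y], with [y] scaled to match [x] at the third index [k],
    leaves [j] as the only difference from [y]. *)
Lemma prel_transversal i j x y : m = 2 -> i != j ->
  exists2 z, prel i x z & prel j z y.
Proof.
move=> m2 ij;
have [|k] := @ord_avoid _ [:: i; j]; first exact: m_ge2.
rewrite !inE negb_or => /andP[ki kj].
pose c := cons1 x k * (cons1 y k)^-1.
pose r l := if l == i then c * cons1 y i else cons1 x l.
exists (hpoint r).
  by apply: (@prel_hpointr _ _ _ _ _ 1) => l li; rewrite /r (negPf li) mul1g.
apply/prel_sym/(@prel_hpointr _ _ _ _ _ c) => l lj; rewrite /r.
have [->//|li] := eqVneq l i; have := three_indices l m2 ij ki kj.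
by rewrite (negPf li) (negPf lj) => /eqP ->; rewrite /c mulgVK.
Qed.

(* For m = 2, a vertex adjacent to all three vertices of a non-collinear
   triangle is on the line through each vertex parallel to the opposite side,
   so there is at most one. *)
Lemma triangle_opposite a b c x y z u : m = 2 ->
  a != b -> x <> y -> x <> z -> y <> z ->
  prel a x y -> prel b x z -> prel c y z ->
  adj u x -> adj u y -> adj u z -> prel c x u.
Proof.
move=> m2 ab neq_xy neq_xz neq_yz xy xz yz.
move=> /diagonal_graphE[neq_ux [d ux]] /diagonal_graphE[neq_uy [e uy]].
move=> /diagonal_graphE[neq_uz [e' uz]].
have meet i j v w : i != j -> prel i v w -> prel j v w -> v = w.
  exact: prel_inter.
have ca : c != a.
  apply/eqP => eq_ca; rewrite eq_ca in yz.
  by apply: neq_xz; apply: (meet _ _ _ _ ab) => //; apply: prel_trans xy yz.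
have cb : c != b.
  apply/eqP => eq_cb; rewrite eq_cb in yz.
  by apply: neq_xy; apply: (meet _ _ _ _ ab) => //; apply: prel_trans xz (prel_sym yz).
have cover l := three_indices l m2 ab ca cb.
(* If [u] were on the line [xy] or [xz], any class for its edge to the remaining vertex would make
   two of the four points coincide. *)
case/or3P: (cover d) => /eqP eq_d; rewrite {}eq_d in ux; last exact: prel_sym.
- have uay := prel_trans ux xy; case/or3P: (cover e') => /eqP eq_e; rewrite {}eq_e in uz.
  + by case: neq_xz; apply: (meet _ _ _ _ ab) => //; apply: prel_trans (prel_sym ux) uz.
  + by case: neq_ux; apply: (meet _ _ _ _ ab) => //; apply: prel_trans uz (prel_sym xz).
  + by case: neq_uy; apply: (meet _ _ _ _ ca) => //; apply: prel_trans uz (prel_sym yz).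
- have ubz := prel_trans ux xz; case/or3P: (cover e) => /eqP eq_e; rewrite {}eq_e in uy.
  + by case: neq_ux; apply: (meet _ _ _ _ ab) => //; apply: prel_trans uy (prel_sym xy).
  + by case: neq_xy; apply: (meet _ _ _ _ ab) => //; apply: prel_trans (prel_sym ux) uy.
  + by case: neq_uz; apply: (meet _ _ _ _ cb) => //; apply: prel_trans uy yz.
Qed.

(* If m = 3 and y and z differ from x in coordinates i and j only, then beside
   x and the fourth point of the parallelogram they have further common
   neighbours exactly when y_i x_i^-1 = x_j z_j^-1 (for x, y, z normalised to
   agree elsewhere), so a third element of T leaves room for a good y. *)
Lemma parallelogram_unique i j x z : 3 <= m ->
  4 <= m \/ (forall r : seq T, size r <= 2 -> exists t, t \notin r) ->
  (exists t : T, t <> 1) ->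
  i != j -> prel j x z -> x <> z ->
  exists y, [/\ y <> x, prel i x y & forall w, adj w y -> adj w z ->
    w = x \/ prel j y w /\ prel i w z].
Proof.
move=> m_ge3 big [t0 t0_1] ij xz neq_xz; have [d zE] := xz.
(* With [z] divided by [d] to agree with [x] off [j], this is the value [x_j z_j^-1] to be avoided
   when [m = 3]. *)
pose b := cons1 x j * (cons1 z j)^-1 * d.
have [t [t1 tb]] : exists t, t <> 1 /\ (4 <= m \/ t <> b).
  case: big => [m4|/(_ [:: 1; b] isT)[t]]; first by exists t0; split=> //; left.
  by rewrite !inE negb_or => /andP[/eqP t1 /eqP tb]; exists t; split=> //; right.
pose h k := if k == i then t * cons1 x i else cons1 x k.
pose y := hpoint h; pose e := (h ord0)^-1.
have yi : cons1 y i = e * (t * cons1 x i) by rewrite cons1_hpoint {2}/h eqxx.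
have yE k : k != i -> cons1 y k = e * cons1 x k.
  by move=> /negPf ki; rewrite cons1_hpoint {2}/h ki.
have xy : prel i x y by exists e.
have neq_yx : y <> x.
  move=> eq_yx; have [|k] := @ord_avoid _ [:: i]; first exact: ltnW m_ge2.
  rewrite inE => ki; have := yE k ki; rewrite eq_yx -{1}[cons1 x k]mul1g => /mulIg e1.
  by apply: t1; move: yi; rewrite eq_yx -e1 mul1g -{1}[cons1 x i]mul1g => /mulIg.
exists y; split=> // w.
move=> /diagonal_graphE[neq_wy [k wy]] /diagonal_graphE[neq_wz [l wz]].
have kl : k != l.
  apply/eqP => eq_kl; rewrite -eq_kl in wz; case/eqP: ij.
  apply: (@triangle_collinear i j k y x z) => //; first exact: prel_sym.
  exact: prel_trans (prel_sym wy) wz.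
have [g yz] : exists g, forall p, p != k -> p != l -> cons1 z p = g * cons1 y p.
  have [c wy'] := wy; have [c' wz'] := wz.
  by exists (c' * c^-1) => p pk pl; rewrite wy' // wz' // !mulgA mulgVK.
(* An index off [i], [j], [k], [l] gives [d = g * e]; if [i] or [j] were outside [{k, l}],
   comparison there would yield [t = 1] or [x = z]. *)
have generic p : p != i -> p != j -> p != k -> p != l ->
    (i \in [:: k; l]) && (j \in [:: k; l]).
  move=> pi pj pk pl; have gE : d = g * e.
    by apply: (mulIg (cons1 x p)); rewrite -zE // yz // yE // mulgA.
  rewrite !inE; apply/andP; split; apply: contraT; rewrite negb_or => /andP[qk ql].
    case: t1; apply: (mulIg (cons1 x i)); apply: (mulgI d).
    by rewrite mul1g -[RHS]zE // yz // yi gE !mulgA.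
  case: neq_xz; apply: (@cons1_inj _ _ _ _ d) => q.
  have [->|/zE //] := eqVneq q j.
  by rewrite yz // yE ?mulgA -?gE // eq_sym.
have : (i \in [:: k; l]) && (j \in [:: k; l]).
  have [iIn|iOut] := boolP (i \in _).
    have [|p] := @ord_avoid _ [:: j; k; l]; first exact: m_ge3.
    rewrite !inE !negb_or => /and3P[pj pk pl].
    have pi : p != i by move: iIn; rewrite !inE => /orP[]/eqP ->.
    by have := generic p pi pj pk pl; rewrite iIn !inE.
  have [jIn|jOut] := boolP (j \in _).
    have [|p] := @ord_avoid _ [:: i; k; l]; first exact: m_ge3.
    rewrite !inE !negb_or => /and3P[pi pk pl].
    have pj : p != j by move: jIn; rewrite !inE => /orP[]/eqP ->.
    by have := generic p pi pj pk pl; rewrite (negPf iOut).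
  case: tb => [m4|tb].
    have [|p] := @ord_avoid _ [:: i; j; k; l]; first exact: m4.
    rewrite !inE !negb_or => /and4P[pi pj pk pl].
    by have := generic p pi pj pk pl; rewrite (negPf iOut).
  (* There may be no fifth index here; comparing [y] and [z] at [i] and at [j] gives [t = b]
     instead. *)
  case: tb; move: iOut jOut; rewrite !inE !negb_or => /andP[ik il] /andP[jk jl].
  have zi := yz i ik il; have zj := yz j jk jl.
  rewrite zE // yi !mulgA in zi; move/mulIg: zi => dE.
  rewrite yE 1?eq_sym // in zj.
  by rewrite /b zj dE !invMg !mulgA mulgV mul1g mulgVK mulVg mul1g.
rewrite !inE => /andP[/orP[]/eqP ei /orP[]/eqP ej]; subst.
- by rewrite eqxx in ij.
- left; apply: (prel_inter m_ge2 ij).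
    exact: prel_trans wy (prel_sym xy).
  exact: prel_trans wz (prel_sym xz).
- by right; split=> //; apply: prel_sym.
- by rewrite eqxx in ij.
Qed.

End GraphGeometry.

(** * Automorphisms of the diagonal graph *)

Section GraphAutomorphisms.
Variables (T : groupType) (m : nat).
Hypothesis m_ge2 : 2 <= m.
Hypothesis T_nontrivial : exists t : T, t <> 1.
Implicit Types (x y z w u v : power T m) (i j k a b : 'I_m.+1).
Implicit Types (f g : power T m -> power T m).

Local Notation adj := (diagonal_graph T m).
Local Notation avoids n := (forall r : seq T, size r <= n -> exists t, t \notin r).

Hypothesis large : (m = 2 /\ avoids 4) \/ (3 <= m /\ (4 <= m \/ avoids 2)).

Section LinesAndClasses.
Variables f g : power T m -> power T m.
Hypotheses (fK : cancel f g) (gK : cancel g f).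
Hypothesis f_adj : forall x y, adj (f x) (f y) <-> adj x y.

(** Points of a line have pairwise adjacent images. For [m = 2], if those of [x], [y], [z] were not
    collinear, two further points [p] and [q] of the line would both go to the one point completing
    that triangle to a clique. *)
Lemma graph_aut_line i a x y z : x <> y ->
  prel i x y -> prel i x z -> prel a (f x) (f y) -> prel a (f x) (f z).
Proof.
move=> neq_xy xy xz fxy.
have adj_line u v : prel i x u -> prel i x v -> u <> v -> adj (f u) (f v).
  move=> xu xv neq_uv; apply/f_adj/diagonal_graphE; split=> //.
  by exists i; apply: prel_trans (prel_sym xu) xv.
have [<-|/eqP neq_xz] := eqVneq x z; first exact: prel_refl.
have [<- //|/eqP neq_yz] := eqVneq y z.
have xx := prel_refl i x.
have /diagonal_graphE[fxz [b xzb]] := adj_line _ _ xx xz neq_xz.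
have /diagonal_graphE[fyz [c yzc]] := adj_line _ _ xy xz neq_yz.
have /diagonal_graphE[nfxy _] := adj_line _ _ xx xy neq_xy.
case: large => [[m2 T5]|[m_ge3 _]]; last first.
  suff -> : a = b by [].
  exact: (triangle_collinear m_ge2 m_ge3 (nesym nfxy) fxz (prel_sym fxy) xzb yzc).
have [-> //|ab] := eqVneq a b.
have [|p xp] := prel_avoid m_ge2 i x (s := [:: x; y; z]) T5; first by [].
rewrite !inE !negb_or => /and3P[/eqP px /eqP py /eqP pz].
have [|q xq] := prel_avoid m_ge2 i x (s := [:: x; y; z; p]) T5; first by [].
rewrite !inE !negb_or => /and4P[/eqP qx /eqP qy /eqP qz /eqP qp].
have opp_x u : prel i x u -> u <> x -> u <> y -> u <> z -> prel c (f x) (f u).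
  by move=> xu ux uy uz;
    apply: (triangle_opposite m_ge2 m2 ab nfxy fxz fyz) => //; apply: adj_line.
have ac : a != c.
  apply/eqP => eq_ac; rewrite -eq_ac in yzc; case: fxz.
  by apply: (prel_inter m_ge2 ab) => //; apply: prel_trans fxy yzc.
have opp_y u : prel i x u -> u <> x -> u <> y -> u <> z -> prel b (f y) (f u).
  move=> xu ux uy uz; apply: (triangle_opposite m_ge2 m2 ac (nesym nfxy) fyz fxz) => //.
  - exact: prel_sym.
  - exact: adj_line.
  - exact: adj_line.
  - exact: adj_line.
have bc : b != c.
  apply/eqP => eq_bc; rewrite -eq_bc in yzc; case: nfxy.
  by apply: (prel_inter m_ge2 ab) => //; apply: prel_trans xzb (prel_sym yzc).
case: qp; apply: (can_inj fK); apply: (prel_inter m_ge2 bc).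
  by apply: prel_trans (prel_sym (opp_y q _ _ _ _)) (opp_y p _ _ _ _).
by apply: prel_trans (prel_sym (opp_x q _ _ _ _)) (opp_x p _ _ _ _).
Qed.

Lemma graph_aut_line_class i x :
  exists a, forall z, prel i x z -> prel a (f x) (f z).
Proof.
have [y xy neq_xy] := prel_nontrivial m_ge2 T_nontrivial i x.
have /diagonal_graphE[_ [a fxy]] : adj (f x) (f y).
  by apply/f_adj/diagonal_graphE; split=> //; exists i.
by exists a => z xz; exact: (graph_aut_line neq_xy xy xz fxy).
Qed.

Lemma graph_aut_line_class_same i a x x' : prel i x x' ->
  (forall z, prel i x z -> prel a (f x) (f z)) ->
  forall z, prel i x' z -> prel a (f x') (f z).
Proof.
move=> xx' fx z x'z.
exact: prel_trans (prel_sym (fx _ xx')) (fx _ (prel_trans xx' x'z)).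
Qed.

(** The fourth vertex of the parallelogram on [f y], [f x], [f x'] pulls back to a common neighbour
    [w] of [y] and [x'] other than [x]. By the choice of [y], [w] is on the line of class [i]
    through [x'], which therefore goes to class [a]. *)
Lemma graph_aut_class_step i j a x x' : 3 <= m -> 4 <= m \/ avoids 2 ->
  prel j x x' -> (forall z, prel i x z -> prel a (f x) (f z)) ->
  forall z, prel i x' z -> prel a (f x') (f z).
Proof.
move=> m_ge3 big xx' fx.
have [eq_ij|ij] := eqVneq i j; first by apply: graph_aut_line_class_same fx; rewrite eq_ij.
have [<- //|/eqP neq_xx'] := eqVneq x x'.
have [y [neq_yx xy unique_y]] :=
  parallelogram_unique m_ge2 m_ge3 big T_nontrivial ij xx' neq_xx'.
have neq_yx' : y <> x'.
  by move=> eq_y; rewrite eq_y in xy; apply/neq_xx'/(prel_inter m_ge2 ij).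
have not_adj : ~ adj y x'.
  move=> /diagonal_graphE[_ [k yx']]; case/eqP: ij.
  exact: (triangle_collinear m_ge2 m_ge3 neq_yx neq_xx' (prel_sym xy) xx' yx').
have fxy := fx _ xy.
have /diagonal_graphE[nfxx' [b fxx']] : adj (f x) (f x').
  by apply/f_adj/diagonal_graphE; split=> //; exists j.
have not_fadj k : ~ prel k (f y) (f x').
  move=> yx'; apply: not_adj; apply/f_adj/diagonal_graphE; split; last by exists k.
  by move=> /(can_inj fK).
have ab : a != b.
  apply/eqP => eq_ab; rewrite -eq_ab in fxx'; apply: (not_fadj a).
  exact: prel_trans (prel_sym fxy) fxx'.
have [w' yw' w'x'] := prel_parallelogram fxy fxx'.
rewrite -(gK w') in yw' w'x'; move: (g w') yw' w'x' => w yw wx'.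
have [|||[yw0 wx'0]] := unique_y w.
- apply/f_adj/diagonal_graphE; split; last by exists b; apply: prel_sym.
  by move=> eq_w; rewrite eq_w in wx'; apply: not_fadj wx'.
- apply/f_adj/diagonal_graphE; split; last by exists a.
  by move=> eq_w; rewrite eq_w in yw; apply: not_fadj yw.
- move=> eq_w; rewrite eq_w in yw; case: neq_yx; apply: (can_inj fK).
  by apply: (prel_inter m_ge2 ab); [apply: prel_sym | ].
have neq_x'w : x' <> w.
  by move=> eq_w; rewrite -eq_w in yw; apply: not_fadj yw.
by move=> z x'z; exact: (graph_aut_line neq_x'w (prel_sym wx'0) x'z (prel_sym wx')).
Qed.

End LinesAndClasses.

Lemma graph_aut_inv f g : cancel f g -> cancel g f ->
  (forall x y, adj (f x) (f y) <-> adj x y) ->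
  forall x y, adj (g x) (g y) <-> adj x y.
Proof. by move=> fK gK f_adj x y; rewrite -f_adj !gK. Qed.

Lemma graph_aut_class f g : cancel f g -> cancel g f ->
  (forall x y, adj (f x) (f y) <-> adj x y) ->
  forall i, exists a, forall x y, prel i x y -> prel a (f x) (f y).
Proof.
move=> fK gK f_adj i; pose o : power T m := [ffun=> 1].
have g_adj := graph_aut_inv fK gK f_adj.
have line_class := graph_aut_line_class fK f_adj.
have [a fo] := line_class i o; exists a => x; move: fo.
case: large => [[m2 _]|[m_ge3 big]] fo; last first.
  (* [pred0] asks for no agreement, so the class [a] is carried from [o] to every point. *)
  apply: (@prel_connected _ _ pred0 (fun x => forall y, prel i x y ->
            prel a (f x) (f y)) o x 1) => // j z w _ zw.
  exact: graph_aut_class_step zw.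
have [b fx] := line_class i x.
have [-> //|ab] := eqVneq a b.
(* Image lines of different classes meet; as [g] also maps lines to lines, pulling back the common
   point [w] shows that the two original lines are the same. *)
have [w ow wx] := prel_transversal m_ge2 (f o) (f x) m2 ab.
have pull c z v : (forall y, prel i z y -> prel c (f z) (f y)) ->
    prel c (f z) v -> prel i z (g v).
  move=> fz zv; have [y zy neq_zy] := prel_nontrivial m_ge2 T_nontrivial i z.
  rewrite -(fK z); apply: (graph_aut_line gK g_adj _ (fz _ zy) zv).
    by move=> /(can_inj fK).
  by rewrite !fK.
have ox : prel i o x.
  exact: prel_trans (pull _ _ _ fo ow) (prel_sym (pull _ _ _ fx (prel_sym wx))).
exact: graph_aut_line_class_same ox fo.
Qed.

Lemma graph_aut_class_perm f : graph_aut adj f -> diag_class_perm f.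
Proof.
move=> [f_bij f_adj]; split=> //; have [g fK gK] := f_bij.
have [s sP] := choice (graph_aut_class fK gK f_adj).
have [s' s'P] := choice (graph_aut_class gK fK (graph_aut_inv fK gK f_adj)).
have s'K : cancel s s'.
  move=> i; apply/esym/(prel_sub_eq m_ge2 T_nontrivial) => x y /sP/s'P.
  by rewrite !fK.
exists (perm (can_inj s'K)) => i x y; rewrite permE; split=> [/sP //|/s'P].
by rewrite s'K !fK.
Qed.

Lemma class_perm_graph_aut f : diag_class_perm f -> graph_aut adj f.
Proof.
move=> [f_bij [s sP]]; split=> // x y; rewrite !diagonal_graphE.
split=> -[neq_xy [i xy]]; split.
- by move=> eq_xy; apply: neq_xy; rewrite eq_xy.
- by exists (s^-1 i); rewrite sP permKV.
- by move=> /(bij_inj f_bij).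
- by exists (s i); rewrite -sP.
Qed.

Lemma graph_autE : graph_aut adj = diagonal_group T m.
Proof.
rewrite diagonal_groupE //; apply/seteqP; split=> f.
  exact: graph_aut_class_perm.
exact: class_perm_graph_aut.
Qed.

End GraphAutomorphisms.

(** * The cardinality of [T] and the excluded cases *)

Lemma card_gt_avoid (T : choiceType) (n : nat) :
  (forall q, ([set: T] #= `I_q)%card -> n < q) ->
  forall r : seq T, size r <= n -> exists t, t \notin r.
Proof.
move=> gt_n r rn; apply: contrapT => all_r.
have rP t : t \in r.
  by apply: contrapT => /negP tr; apply: all_r; exists t.
(* A list exhausting [T] makes it finite, so the hypothesis, vacuous for infinite [T], yields a
   contradiction. *)
have [q Tq] : exists q, ([set: T] #= `I_q)%card.
  apply/finite_setP; rewrite (_ : setT = [set` r]%classic); first exact: finite_seq.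
  by apply/seteqP; split=> t _ //=; apply: rP.
have := gt_n q Tq; rewrite ltnNge -card_le_II -(card_le_eql Tq) => /negP; apply.
have idx_inj : {in [set: T]%classic &, injective (fun t => index t r)}.
  by move=> t u _ _; apply: index_inj.
rewrite -(card_le_eql (inj_card_eq idx_inj)); apply: subset_card_le => _ [t _ <-] /=.
by apply: leq_trans rn; rewrite index_mem.
Qed.

Lemma nontrivial_card_gt1 (T : Type) (x y : T) (q : nat) :
  x <> y -> ([set: T] #= `I_q)%card -> 1 < q.
Proof.
move=> neq_xy; case: q => [|[|//]].
  by rewrite II0 card_eq0 => /eqP T0; have : set0 x by rewrite -T0.
move=> /eq_cardSP[z _]; rewrite II0 card_eq0 => /eqP Tz; case: neq_xy.
have eq_z t : t = z by apply: contrapT => tz; have : set0 t by rewrite -Tz.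
by rewrite (eq_z x) (eq_z y).
Qed.

Theorem theorem1p4 (T : groupType) (m : nat)
    (T_nontrivial : exists t : T, t <> 1%g) (m_ge2 : 2 <= m) :
  partition_set_aut (diagonal_semilattice T m) = diagonal_group T m
  /\ ((forall q : nat, ([set: T] #= `I_q)%card ->
         (q, m) \notin [:: (2, 2); (3, 2); (4, 2); (2, 3)]) ->
      graph_aut (diagonal_graph T m) = diagonal_group T m).
Proof.
split; first exact: semilattice_autE.
move=> not_small; apply: graph_autE => //.
have [t t1] := T_nontrivial; have gt1 q := @nontrivial_card_gt1 T t 1 q t1.
have [m_gt2|m_le2] := ltnP 2 m.
  right; split=> //; move: m_gt2; rewrite leq_eqVlt => /orP[/eqP m3|]; last by left.
  (* Non-triviality rules out 0 and 1, so excluding 2 leaves cardinalities above 2; for [m = 2]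
     below, excluding 2, 3 and 4 leaves those above 4. *)
  right; apply: card_gt_avoid => q Tq; have := not_small q Tq.
  by rewrite -m3; case: q {Tq} (gt1 q Tq) => [|[|[|]]].
have m2 : m = 2 by apply/eqP; rewrite eqn_leq m_le2.
left; split=> //; apply: card_gt_avoid => q Tq; have := not_small q Tq.
by rewrite m2; case: q {Tq} (gt1 q Tq) => [|[|[|[|[|]]]]].
Qed.
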